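(* For an Abelian group $G$ with maximal torsion subgroup $T$, the following are equivalent: (a) $G$ is finitely co-Bassian; (b) $G$ is semi co-Bassian; (c) $G$ has finite torsion-free rank and, for each prime $p$, $T_p$ has finite $p$-rank.
   Context: All groups are Abelian, written additively. An injection between groups means an injective homomorphism. $T = T(G)$ is the maximal torsion subgroup of $G$ and $T_p$ is its $p$-primary component. The torsion-free rank of $G$ is the rank of $G/T$. The $p$-rank of $T_p$ is the dimension of its socle $T_p[p] = \{x \in T_p : px = 0\}$ over the field with $p$ elements. A subgroup $E$ of a group $X$ is essential in $X$ if $E \cap S \neq \{0\}$ for every non-zero subgroup $S$ of $X$. A group $G$ is finitely co-Bassian if, for every subgroup $H \leq G$ and every injection $\phi : G \to G/H$, $\phi(G)$ has finite index in $G/H$. A group $G$ is semi co-Bassian if, for every subgroup $H \leq G$ and every injection $\phi : G \to G/H$, $\phi(G)$ is essential in $G/H$. *)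

(* Defs.v *)
From HB Require Import structures.
From mathcomp Require Import all_boot all_order all_algebra.
From mathcomp Require Import boolp classical_sets functions cardinality.

Set Implicit Arguments.
Unset Strict Implicit.
Unset Printing Implicit Defensive.

Import GRing.Theory.

Local Open Scope ring_scope.

(* Abelian groups are [zmodType]s and subgroups are [zmodClosed] predicates.
   Membership is boolean, but [`[< _ >]] (classical) turns every Prop-valued
   predicate into a boolean one, so every subgroup is covered. *)

Notation "G '/s' H" := (@Quotient.quot G H) (at level 40) : type_scope.

Definition additive_image (A B : zmodType) (f : {additive A -> B}) : pred B :=
  fun y => `[< exists x, f x = y >].

Lemma additive_image_closed (A B : zmodType) (f : {additive A -> B}) :
  zmod_closed (additive_image f).
Proof.
split; first by apply/asboolP; exists 0; rewrite raddf0.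
move=> _ _ /asboolP[x <-] /asboolP[y <-].
by apply/asboolP; exists (x - y); rewrite raddfB.
Qed.

HB.instance Definition _ (A B : zmodType) (f : {additive A -> B}) :=
  GRing.isZmodClosed.Build B (additive_image f) (additive_image_closed f).

Definition image_subgroup (A B : zmodType) (f : {additive A -> B}) :
  zmodClosed B := GRing.ZmodClosed.clone B (additive_image f) _.

Definition finite_index (X : zmodType) (E : zmodClosed X) : Prop :=
  finite_set [set: X /s E].

Definition essential (X : zmodType) (E : zmodClosed X) : Prop :=
  forall S : zmodClosed X, (exists2 x, x \in S & x != 0) ->
    exists x, [/\ x \in E, x \in S & x != 0].

Definition finitely_co_Bassian (G : zmodType) : Prop :=
  forall (H : zmodClosed G) (phi : {additive G -> G /s H}),
    injective phi -> finite_index (image_subgroup phi).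

Definition semi_co_Bassian (G : zmodType) : Prop :=
  forall (H : zmodClosed G) (phi : {additive G -> G /s H}),
    injective phi -> essential (image_subgroup phi).

Definition torsion (G : zmodType) : pred G :=
  fun x => `[< exists2 n, (0 < n)%N & x *+ n = 0 >].

Lemma torsion_closed (G : zmodType) : zmod_closed (@torsion G).
Proof.
split; first by apply/asboolP; exists 1%N; rewrite ?mul0rn.
move=> x y /asboolP[m m0 xm] /asboolP[n n0 yn].
apply/asboolP; exists (m * n)%N; first by rewrite muln_gt0 m0.
by rewrite mulrnBl mulrnA xm mulnC mulrnA yn !mul0rn subrr.
Qed.

HB.instance Definition _ (G : zmodType) :=
  GRing.isZmodClosed.Build G (@torsion G) (@torsion_closed G).

Definition torsion_subgroup (G : zmodType) : zmodClosed G :=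
  GRing.ZmodClosed.clone G (@torsion G) _.

Definition int_independent (A : zmodType) (n : nat) (v : 'I_n -> A) : Prop :=
  forall c : 'I_n -> int, \sum_(i < n) v i *~ c i = 0 -> forall i, c i = 0.

(* The rank of a torsion-free group: the maximal size of an independent
   family. *)
Definition has_rank (A : zmodType) (n : nat) : Prop :=
  (exists v : 'I_n -> A, int_independent v) /\
  (forall m (v : 'I_m -> A), int_independent v -> (m <= n)%N).

Definition finite_torsion_free_rank (G : zmodType) : Prop :=
  exists n, has_rank (G /s torsion_subgroup G) n.

Definition primary_component (p : nat) (G : zmodType) : pred G :=
  fun x => (x \in torsion_subgroup G) && `[< exists k, x *+ p ^ k = 0 >].

Definition primary_socle (p : nat) (G : zmodType) : pred G :=
  fun x => (x \in @primary_component p G) && (x *+ p == 0).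

Lemma primary_socle_closed p G : zmod_closed (@primary_socle p G).
Proof.
split.
  apply/andP; split; last by rewrite mul0rn.
  apply/andP; split; first exact: rpred0.
  by apply/asboolP; exists 0%N; rewrite mul0rn.
move=> x y /andP[/andP[xT _] /eqP xp] /andP[/andP[yT _] /eqP yp].
have xyp : (x - y) *+ p = 0 by rewrite mulrnBl xp yp subrr.
apply/andP; split; last exact/eqP.
apply/andP; split; first exact: rpredB.
by apply/asboolP; exists 1%N.
Qed.

HB.instance Definition _ p G :=
  GRing.isZmodClosed.Build G (@primary_socle p G) (@primary_socle_closed p G).

(* T_p[p] as a vector space; the primality proof is a parameter of the type
   because ['F_p] acts only when p is prime. *)
Record socle (p : nat) (pr_p : prime p) (G : zmodType) := Socle {
  socle_val : G;
  _ : socle_val \in @primary_socle p G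
}.

HB.instance Definition _ p pr_p G := [isSub for @socle_val p pr_p G].
HB.instance Definition _ p pr_p G := [Choice of @socle p pr_p G by <:].
HB.instance Definition _ p pr_p G :=
  [SubChoice_isSubZmodule of @socle p pr_p G by <:].

Section SocleVectorSpace.
Variables (p : nat) (pr_p : prime p) (G : zmodType).
Local Notation V := (@socle p pr_p G).

Definition socle_scale (c : 'F_p) (x : V) : V := x *+ (c : nat).

Lemma socle_mulrn_mod (x : V) n : x *+ (n %% (Zp_trunc (pdiv p)).+2) = x *+ n.
Proof.
rewrite Fp_cast //.
have xp : x *+ p = 0.
  apply: val_inj; rewrite raddfMn raddf0.
  by case: x => x /= /andP[_ /eqP].
by rewrite {2}(divn_eq n p) mulrnDr mulnC mulrnA xp mul0rn add0r.
Qed.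

Lemma socle_scaleA a b x :
  socle_scale a (socle_scale b x) = socle_scale (a * b) x.
Proof.
by rewrite /socle_scale -mulrnA /= socle_mulrn_mod mulnC.
Qed.

Lemma socle_scale1 : left_id 1 socle_scale.
Proof. by move=> x; rewrite /socle_scale /= socle_mulrn_mod. Qed.

Lemma socle_scaleDr : right_distributive socle_scale +%R.
Proof. by move=> a x y; rewrite /socle_scale mulrnDl. Qed.

Lemma socle_scaleDl x : {morph socle_scale^~ x : a b / a + b}.
Proof.
by move=> a b; rewrite /socle_scale /= socle_mulrn_mod mulrnDr.
Qed.

HB.instance Definition _ := GRing.Zmodule_isLmodule.Build 'F_p V
  socle_scaleA socle_scale1 socle_scaleDr socle_scaleDl.

End SocleVectorSpace.

Definition has_dim (F : fieldType) (V : lmodType F) (n : nat) : Prop :=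
  exists f : {linear V -> 'rV[F]_n}, bijective f.

Definition finite_p_rank (p : nat) (pr_p : prime p) (G : zmodType) : Prop :=
  exists n, has_dim (socle pr_p G) n.

(* Main.v *)
From HB Require Import structures.
From mathcomp Require Import all_boot all_order all_algebra.
From mathcomp Require Import boolp classical_sets functions cardinality.
From mathcomp Require Import ring.
Require Import Defs.

(* Sufficiency of the finiteness conditions is a counting argument. Let [F] be
   free on a maximal independent family, so that [G / F] is torsion with
   finite [k]-torsion, and write [phi F] as the image of [U] in [G / H]. For
   some [d > 0], [d F] is contained in [U], hence [Y = (G / H) / phi F] is a
   quotient of the torsion group [G / d F]. A quotient of a torsion group has
   at most as much [k]-torsion as the group itself, so the [k]-torsion of [Y]
   is at most [d ^ n] times that of [G / F], which [phi] embeds in [Y]: [phi G]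
   has index at most [d ^ n]. The same count shows that [phi] is onto the
   [p]-torsion of [G / H], which gives essentiality.

   Conversely, suppose that one of the ranks is infinite. Then [G] contains a
   direct sum [F] of cyclic groups with an embedding [F -> W] and a surjection
   [F -> W * W] that both extend to [G], where [W] is a direct sum of copies
   of [Q] (infinite torsion-free rank), of [Z(p^oo)] ([p ^ k G] has infinite
   [p]-socle for all [k]) or of [Z / p ^ (k + 1)] (infinitely many independent
   socle elements of height exactly [k]). With [H] the kernel of [F -> W * W],
   the quotient [G / H] contains [G * W]. *)

Set Implicit Arguments.
Unset Strict Implicit.
Unset Printing Implicit Defensive.

Import Order.TTheory GRing.Theory Num.Theory.

Local Open Scope ring_scope.

(** * Subgroups as propositional predicates, and quotients *)

Lemma subrACA (A : zmodType) (a b c d : A) :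
  a - b - (c - d) = a - c - (b - d).
Proof. by rewrite [in RHS]opprD addrACA -opprD. Qed.

(** Auxiliary subgroups stay unbundled; [subgroup_of] packages one where a quotient is formed. *)
Definition is_subgroup (A : zmodType) (P : A -> Prop) : Prop :=
  P 0 /\ forall x y, P x -> P y -> P (x - y).

Section SubgroupTheory.
Variables (A : zmodType) (P : A -> Prop).
Hypothesis sgP : is_subgroup P.

Lemma sg0 : P 0. Proof. by case: sgP. Qed.

Lemma sgB x y : P x -> P y -> P (x - y).
Proof. by case: sgP => _; apply. Qed.

Lemma sgN x : P x -> P (- x).
Proof. by move=> Px; rewrite -sub0r; apply: sgB => //; exact: sg0. Qed.

Lemma sgD x y : P x -> P y -> P (x + y).
Proof. by move=> Px Py; rewrite -[y]opprK; apply: sgB => //; exact: sgN. Qed.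

Lemma sgMn x n : P x -> P (x *+ n).
Proof.
move=> Px; elim: n => [|n IHn]; first by rewrite mulr0n; exact: sg0.
by rewrite mulrS; apply: sgD.
Qed.

Lemma sgMz x c : P x -> P (x *~ c).
Proof. by case: c => n Px; [exact: sgMn|apply: sgN; exact: sgMn]. Qed.

Lemma sg_sum (I : finType) (F : I -> A) :
  (forall i, P (F i)) -> P (\sum_i F i).
Proof. by move=> PF; elim/big_ind: _ => //; [exact: sg0|exact: sgD]. Qed.

Lemma sg_subDl x y : P x -> P (x + y) -> P y.
Proof. by move=> Px Pxy; rewrite -(addKr x y) addrC; apply: sgB. Qed.

Lemma sg_sub_trans y x z : P (x - y) -> P (y - z) -> P (x - z).
Proof. by move=> Pxy Pyz; rewrite -(subrKA y); apply: sgD. Qed.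

Lemma sg_sub_sym x y : P (x - y) -> P (y - x).
Proof. by move=> /sgN; rewrite opprB. Qed.

Fact subgroup_of_closed : zmod_closed (fun x => `[< P x >]).
Proof.
split; first by apply/asboolP; exact: sg0.
by move=> x y /asboolP Px /asboolP Py; apply/asboolP; exact: sgB.
Qed.

Definition subgroup_of_pred of is_subgroup P : pred A := fun x => `[< P x >].

HB.instance Definition _ (h : is_subgroup P) :=
  GRing.isZmodClosed.Build A (subgroup_of_pred h) subgroup_of_closed.

Definition subgroup_of : zmodClosed A :=
  GRing.ZmodClosed.clone A (subgroup_of_pred sgP) _.

Lemma subgroup_ofE x : x \in subgroup_of <-> P x.
Proof. by split=> [/asboolP|Px]; [|apply/asboolP]. Qed.

End SubgroupTheory.

Lemma zmodClosed_subgroup (A : zmodType) (H : zmodClosed A) :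
  is_subgroup (fun x => x \in H).
Proof. by split=> [|x y]; [exact: rpred0|exact: rpredB]. Qed.

Lemma trivial_subgroup (A : zmodType) : is_subgroup (fun x : A => x = 0).
Proof. by split=> // x y -> ->; rewrite subrr. Qed.

Lemma preim_subgroup (A B : zmodType) (f : {additive A -> B}) (P : B -> Prop) :
  is_subgroup P -> is_subgroup (fun x => P (f x)).
Proof.
by move=> sP; split=> [|x y Px Py]; rewrite (raddf0, raddfB);
  [exact: sg0|apply: sgB].
Qed.

Lemma mulrn_preim_subgroup (A : zmodType) (P : A -> Prop) m :
  is_subgroup P -> is_subgroup (fun x => P (x *+ m)).
Proof.
by move=> sP; split=> [|x y Px Py]; rewrite (mul0rn, mulrnBl);
  [exact: sg0|apply: sgB].
Qed.

Lemma mulrn_im_subgroup (A : zmodType) (P : A -> Prop) m :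
  is_subgroup P -> is_subgroup (fun x => exists2 y, P y & x = y *+ m).
Proof.
move=> sP; split=> [|_ _ [x Px ->] [y Py ->]].
  by exists 0; rewrite ?mul0rn //; exact: sg0.
by exists (x - y); rewrite ?mulrnBl //; apply: sgB.
Qed.

Lemma add_subgroup (A : zmodType) (P Q : A -> Prop) :
  is_subgroup P -> is_subgroup Q ->
  is_subgroup (fun x => exists y z, [/\ P y, Q z & x = y + z]).
Proof.
move=> sP sQ; split=> [|_ _ [y [z [Py Qz ->]]] [y' [z' [Py' Qz' ->]]]].
  by exists 0, 0; split; [exact: sg0|exact: sg0|rewrite addr0].
exists (y - y'), (z - z'); split; [exact: sgB|exact: sgB|].
by rewrite opprD addrACA.
Qed.

Lemma and_subgroup (A : zmodType) (P Q : A -> Prop) :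
  is_subgroup P -> is_subgroup Q -> is_subgroup (fun x => P x /\ Q x).
Proof.
move=> sP sQ; split=> [|x y [Px Qx] [Py Qy]]; first by split; exact: sg0.
by split; apply: sgB.
Qed.

Lemma exists_exponent (A : zmodType) (P : A -> Prop) (s : seq A) :
  is_subgroup P -> (forall x, x \in s -> exists2 e, (0 < e)%N & P (x *+ e)) ->
  exists2 e, (0 < e)%N & forall x, x \in s -> P (x *+ e).
Proof.
move=> sP; elim: s => [|a s IHs] tors; first by exists 1%N.
have [|e e0 eP] := IHs; first by move=> x xs; apply: tors; rewrite inE xs orbT.
have [d d0 dP] := tors _ (mem_head _ _).
exists (d * e)%N; first by rewrite muln_gt0 d0.
move=> x; rewrite in_cons => /orP[/eqP->|xs].
  by rewrite mulrnA; apply: sgMn.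
by rewrite mulnC mulrnA; apply: sgMn => //; exact: eP.
Qed.

Section Quotients.
Variables (G : zmodType) (H : zmodClosed G).

Definition qpi (x : G) : G /s H := \pi_(G /s H)%qT x.

Fact qpi_is_zmod_morphism : zmod_morphism qpi.
Proof. by move=> x y; rewrite /qpi !piE. Qed.

HB.instance Definition _ :=
  GRing.isZmodMorphism.Build G (G /s H) qpi qpi_is_zmod_morphism.

Lemma qpi_reprK (y : G /s H) : qpi (repr y) = y.
Proof. exact: reprK. Qed.

Lemma qpi_eq x y : qpi x = qpi y <-> x - y \in H.
Proof. by rewrite Quotient.idealrBE; split=> [xy|/eqP//]; apply/eqP. Qed.

Lemma qpi_eq0 x : qpi x = 0 <-> x \in H.
Proof. by have := qpi_eq x 0; rewrite raddf0 subr0. Qed.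

End Quotients.

(** * Finite indices through covering and separated lists *)

Definition covers (A : zmodType) (Q P : A -> Prop) (t : seq A) : Prop :=
  forall x, Q x -> exists2 y, y \in t & P (x - y).

Definition separated (A : zmodType) (P : A -> Prop) (s : seq A) : Prop :=
  uniq s /\ forall x y, x \in s -> y \in s -> P (x - y) -> x = y.

Section Transversals.
Variable A : zmodType.
Implicit Types P Q : A -> Prop.

(** Pigeonhole: sending each member of [s] to a congruent member of [t] is injective. Separated
    lists thus bound a number of classes from below, covers from above. *)
Lemma separated_leq_cover Q P s t : is_subgroup P -> separated P s ->
  (forall x, x \in s -> Q x) -> covers Q P t -> (size s <= size t)%N.
Proof.
move=> sP [us inj_s] sQ cov.
have /choice[f fP] x : exists y, x \in s -> y \in t /\ P (x - y).
  have [/sQ/cov[y yt Pxy]|_] := boolP (x \in s); last by exists 0.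
  by exists y.
rewrite -(size_map f); apply: uniq_leq_size; last first.
  by move=> _ /mapP[x /fP[fx _] ->].
rewrite map_inj_in_uniq // => x y xs ys fxy; apply: inj_s => //.
apply: (sg_sub_trans sP (proj2 (fP _ xs))); rewrite fxy.
exact: (sg_sub_sym sP (proj2 (fP _ ys))).
Qed.

Lemma transversal_exists Q P s : is_subgroup P -> covers Q P s ->
  exists t, [/\ covers Q P t, separated P t & forall x, x \in t -> Q x].
Proof.
move=> sP cov.
(* Strengthened for induction on [s]: only elements of [Q] congruent to a member of [s] have to be
   covered. *)
suff [t [tcov tsep tQ]] : exists t, [/\ forall x, Q x ->
    (exists2 y, y \in s & P (x - y)) -> exists2 y, y \in t & P (x - y),
    separated P t & forall x, x \in t -> Q x].
  by exists t; split=> // x Qx; apply: tcov => //; exact: cov.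
elim: s {cov} => [|a s [t [tcov [ut tsep] tQ]]].
  by exists [::]; split=> // x _ [].
have [[x [Qx Pxa xt]]|nx] := pselect (exists x, [/\ Q x, P (x - a) &
    ~ exists2 y, y \in t & P (x - y)]); last first.
  exists t; split=> // x Qx [y]; rewrite inE => /orP[/eqP->|ys] Pxy; last first.
    by apply: tcov => //; exists y.
  by have [//|nt] := pselect (exists2 y, y \in t & P (x - y));
    case: nx; exists x.
exists (x :: t); split=> [z Qz [y]||z]; last by rewrite inE => /orP[/eqP->|/tQ].
  rewrite inE => /orP[/eqP->|ys] Pzy.
    exists x; first exact: mem_head.
    exact: (sg_sub_trans sP Pzy (sg_sub_sym sP Pxa)).
  have [|w wt Pzw] := tcov z Qz; first by exists y.
  by exists w => //; rewrite inE wt orbT.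
split=> [|y z]; first rewrite /= ut andbT; first apply/negP => xt'.
  by case: xt; exists x => //; rewrite subrr; exact: sg0.
rewrite !inE => /orP[/eqP->|yt] /orP[/eqP->|zt] // Pyz.
- by case: xt; exists z.
- by case: xt; exists y => //; exact: sg_sub_sym.
- exact: tsep.
Qed.

(* [f] is arbitrary, so that both preimages and intersections are covered. *)
Lemma covers_pullback (B : zmodType) (f : A -> B) (Q P : B -> Prop)
    (Q' P' : A -> Prop) t :
  is_subgroup P -> covers Q P t -> (forall x, Q' x -> Q (f x)) ->
  (forall x y, Q' x -> Q' y -> P (f x - f y) -> P' (x - y)) ->
  exists2 t', (size t' <= size t)%N & covers Q' P' t'.
Proof.
move=> sP cov Qf Pf.
have /choice[g gP] y : exists x,
    (exists2 x', Q' x' & P (f x' - y)) -> Q' x /\ P (f x - y).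
  have [[x Q'x Pxy]|nx] := pselect (exists2 x', Q' x' & P (f x' - y)).
    by exists x.
  by exists 0.
exists [seq g y | y <- t]; first by rewrite size_map.
move=> x Q'x; have [y yt Pxy] := cov _ (Qf _ Q'x).
exists (g y); first exact: map_f.
have [|Qg Pg] := gP y; first by exists x.
by apply: Pf => //; exact: (sg_sub_trans sP Pxy (sg_sub_sym sP Pg)).
Qed.

Lemma covers_sub Q Q' P t : is_subgroup P -> covers Q P t ->
  (forall x, Q' x -> Q x) ->
  exists2 t', (size t' <= size t)%N & covers Q' P t'.
Proof. by move=> sP cov QQ; apply: (covers_pullback (f := id) sP cov). Qed.

Lemma covers_trans Q P R s t : covers Q P s -> covers P R t ->
  covers Q R [seq x + y | x <- s, y <- t].
Proof.
move=> covs covt x /covs[y ys /covt[z zt Rxyz]].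
exists (y + z); last by rewrite opprD addrA.
by apply/allpairsP; exists (y, z).
Qed.

(* Inside [L_e = {x in L | e x in B}], whose quotient by [B] is finite, the
   index of [m L_e] is the order of the [m]-torsion. *)
Lemma separated_size_torsion (L K B : A -> Prop) m
    (s t : seq A) :
  is_subgroup L -> is_subgroup K -> is_subgroup B ->
  (forall x, B x -> K x) -> (forall x, L x -> K (x *+ m)) ->
  (forall e, (0 < e)%N -> exists u, covers (fun x => B (x *+ e)) B u) ->
  (forall x, x \in s -> L x) ->
  (forall x, x \in s -> exists2 e, (0 < e)%N & B (x *+ e)) ->
  separated K s -> covers (fun x => B (x *+ m)) B t -> (size s <= size t)%N.
Proof.
move=> sL sK sB BK LmK fin sL' stor [us sepK] covt.
have [e e0 eP] := exists_exponent sB stor.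
pose Le x := L x /\ B (x *+ e).
have sLe : is_subgroup Le.
  by apply: and_subgroup => //; exact: mulrn_preim_subgroup.
pose mLe x := exists2 y, Le y & x = y *+ m.
have [u covu] := fin e e0.
have [u' _ covu'] : exists2 u', (size u' <= size u)%N & covers mLe B u'.
  apply: covers_sub covu _ => // _ [y [_ By] ->].
  by rewrite mulrnAC; exact: sgMn.
have {u u' covu covu'} [y [covy sepy ymLe]] := transversal_exists sB covu'.
have /choice[pre preP] z : exists x, z \in y -> Le x /\ z = x *+ m.
  have [/ymLe[x Lx ->]|_] := boolP (z \in y); last by exists 0.
  by exists x.
have y_gt0 : (0 < size y)%N.
  have [|z zy _] := covy 0; last by case: (y) zy.
  by exists 0; rewrite ?mul0rn //; exact: sg0 sLe.
(* Lower bound: the sums are distinct modulo [B], because [b] lies in [K], so that [a] is determined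
   modulo [K] and then [b] modulo [B]. *)
have pair_inj a b c d : a \in s -> b \in y -> c \in s -> d \in y ->
    B (a + b - (c + d)) -> (a, b) = (c, d).
  move=> a_s b_y c_s d_y; rewrite opprD addrACA => Babcd.
  have mLeK z : mLe z -> K z by case=> w [Lw _] ->; exact: LmK.
  have eac : a = c.
    apply: sepK => //; apply: (sg_subDl (x := b - d) sK).
      by apply: sgB => //; apply: mLeK; exact: ymLe.
    by rewrite addrC; exact: BK.
  move: Babcd; rewrite eac subrr add0r => Bbd.
  by congr pair; apply: (proj2 sepy).
suff : (size [seq (a + b)%R | a <- s, b <- y] <=
        size [seq (pre b + c)%R | b <- y, c <- t])%N.
  by rewrite !size_allpairs mulnC leq_pmul2l.
apply: (@separated_leq_cover Le B) => //.
- split=> [|x z].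
    apply: allpairs_uniq => //; first by case: sepy.
    move=> [a b] [c d] /allpairsP[[a' b'] /= [a_s b_y [-> ->]]].
    move=> /allpairsP[[c' d'] /= [c_s d_y [-> ->]]] eq_abcd.
    by apply: pair_inj => //; rewrite eq_abcd subrr; exact: sg0.
  move=> /allpairsP[[a b] /= [a_s b_y ->]] /allpairsP[[c d] /= [c_s d_y ->]].
  by move=> /(pair_inj _ _ _ _ a_s b_y c_s d_y)[-> ->].
- move=> _ /allpairsP[[a b] /= [a_s b_y ->]]; apply: sgD => //.
    by split; [exact: sL'|exact: eP].
  by have [w Lw ->] := ymLe _ b_y; exact: sgMn.
(* Upper bound: [x] differs from the chosen preimage of the class of [m x] by an element that [m]
   sends into [B]. *)
- move=> x Lx; have [|z zy Bxz] := covy (x *+ m); first by exists x.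
  have [Lpz zE] := preP _ zy.
  have [|c ct Bc] := covt (x - pre z); first by rewrite mulrnBl -zE.
  exists (pre z + c); last by rewrite opprD addrA.
  by apply/allpairsP; exists (z, c).
Qed.

End Transversals.

(** * Spans of finite families and finiteness of torsion *)

Definition span (A : zmodType) n (v : 'I_n -> A) (x : A) : Prop :=
  exists c : 'I_n -> int, x = \sum_(i < n) v i *~ c i.

Lemma span_subgroup (A : zmodType) n (v : 'I_n -> A) : is_subgroup (span v).
Proof.
split=> [|_ _ [c ->] [d ->]].
  by exists (fun=> 0); rewrite big1 // => i _; rewrite mulr0z.
exists (fun i => c i - d i); rewrite -sumrB.
by apply: eq_bigr => i _; rewrite mulrzBr.
Qed.

Lemma mem_span (A : zmodType) n (v : 'I_n -> A) i : span v (v i).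
Proof.
exists (fun j => (j == i)%:Z); rewrite (bigD1 i) //= eqxx mulr1z big1 ?addr0 //.
by move=> j /negPf->; rewrite mulr0z.
Qed.

Lemma span_sub (A : zmodType) n (v : 'I_n -> A) (P : A -> Prop) :
  is_subgroup P -> (forall i, P (v i)) -> forall x, span v x -> P x.
Proof.
move=> sP Pv _ [c ->]; apply: sg_sum => // i; exact: sgMz.
Qed.

Lemma covers_span (A : zmodType) n (v : 'I_n -> A) d : (0 < d)%N ->
  exists t, covers (span v) (span (fun i => v i *+ d)) t.
Proof.
case: d => // d _.
exists [seq \sum_i v i *+ f i | f : {ffun 'I_n -> 'I_d.+1}] => _ [c ->].
have ltc i : (`|(c i %% d.+1)%Z| < d.+1)%N.
  by rewrite -ltz_nat gez0_abs ?modz_ge0 // ltz_pmod.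
exists (\sum_i v i *+ [ffun i => Ordinal (ltc i)] i).
  by apply/mapP; exists [ffun i => Ordinal (ltc i)]; rewrite ?mem_enum.
exists (fun i => (c i %/ d.+1)%Z); rewrite -sumrB.
apply: eq_bigr => i _; rewrite ffunE /= {1}(divz_eq (c i) d.+1).
by rewrite [X in _ - X]pmulrn gez0_abs ?modz_ge0 // mulrzDr addrK mulrC mulrzA.
Qed.

Definition finite_torsion (G : zmodType) : Prop :=
  forall m, (0 < m)%N -> exists t, covers (fun x : G => x *+ m = 0) (eq^~ 0) t.

(** Multiplication by a prime divisor [p] of [m] maps the [m]-torsion to the [m / p]-torsion, with
    kernel in the [p]-torsion. *)
Lemma prime_finite_torsion (G : zmodType) :
  (forall p, prime p ->
    exists t, covers (fun x : G => x *+ p = 0) (eq^~ 0) t) ->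
  finite_torsion G.
Proof.
move=> fin m; elim/ltn_ind: m => m IHm m0.
have [m1|m1] := leqP m 1.
  exists [:: 0] => x; have ->: m = 1%N by apply/eqP; rewrite eqn_leq m1 m0.
  by rewrite mulr1n => ->; exists 0; rewrite ?inE // subr0.
have p_pr := pdiv_prime m1; have [q mE] := dvdnP (pdiv_dvd m).
set p := pdiv m in p_pr mE.
have p1 := prime_gt1 p_pr.
have q0 : (0 < q)%N by move: m0; rewrite mE muln_gt0 => /andP[].
have [||t covt] := IHm q => //; first by rewrite mE ltn_Pmulr.
have [s covs] := fin _ p_pr.
have [t' _ covt'] : exists2 t', (size t' <= size t)%N &
    covers (fun x : G => x *+ m = 0) (fun x => x *+ p = 0) t'.
  apply: (covers_pullback (f := fun x => x *+ p) (trivial_subgroup G) covt).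
    by move=> x; rewrite mE mulnC mulrnA.
  by move=> x y _ _; rewrite mulrnBl.
by eexists; apply: covers_trans covt' covs.
Qed.

(** With [F] the span, [F / e F] is finite; and if [e x] lies in [e F], then [x] differs from an
    element of [F] by [e]-torsion. *)
Lemma finite_torsion_mod_span (G : zmodType) n (v : 'I_n -> G) e :
  finite_torsion G -> (0 < e)%N ->
  exists t, covers (fun x => span v (x *+ e)) (span v) t.
Proof.
move=> fin e0; have [s covs] := covers_span v e0; have [t covt] := fin e e0.
have [s' _ covs'] : exists2 s', (size s' <= size s)%N &
    covers (fun x => span v (x *+ e))
      (fun x => span (fun i => v i *+ e) (x *+ e)) s'.
  apply: (covers_pullback (f := fun x => x *+ e) (span_subgroup _) covs) => //.
  by move=> x y _ _; rewrite mulrnBl.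
suff [t' covt'] : exists t',
    covers (fun x => span (fun i => v i *+ e) (x *+ e)) (span v) t'.
  by eexists; apply: covers_trans covs' covt'.
exists t => x [c xe].
have [|y yt] := covt (x - \sum_i v i *~ c i).
  rewrite mulrnBl xe -sumrMnl -sumrB big1 // => i _.
  by rewrite !pmulrn -!mulrzA mulrC subrr.
move=> xy; exists y => //; exists c; apply/eqP; rewrite -subr_eq0 addrAC.
exact/eqP.
Qed.

(** * Torsion-free rank and maximal independent families *)

Section Rank.
Variable G : zmodType.

Lemma quot_torsionP (x : G) :
  qpi (torsion_subgroup G) x = 0 <-> exists2 n, (0 < n)%N & x *+ n = 0.
Proof. by rewrite qpi_eq0; split=> /asboolP. Qed.

(** A relation modulo torsion becomes a relation in [G] once multiplied by the order of its
    value. *)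
Lemma int_independent_quot_torsion n (v : 'I_n -> G) :
  int_independent (fun i => qpi (torsion_subgroup G) (v i)) <->
  int_independent v.
Proof.
split=> [iv c cv0|iv c].
  apply: iv; under eq_bigr do rewrite -raddfMz.
  by rewrite -raddf_sum cv0 raddf0.
under eq_bigr do rewrite -raddfMz.
rewrite -raddf_sum => /quot_torsionP[m m0]; rewrite -sumrMnl => cv0 i.
have : c i *~ m%:Z = 0.
  apply: (iv (fun i => c i *~ m%:Z)); rewrite -[RHS]cv0.
  by apply: eq_bigr => j _; rewrite mulrzz mulrzA pmulrn.
by move/eqP; rewrite mulrzz mulf_eq0 => /orP[/eqP//|]; case: (m) m0.
Qed.

(** Adjoining [x] to [w] exceeds the rank, so there is a relation, and independence of [w] makes the
    coefficient of [x] in it non-zero. *)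
Lemma has_rank_span n : has_rank (G /s torsion_subgroup G) n ->
  (exists v : 'I_n -> G, int_independent v) /\
  forall w : 'I_n -> G, int_independent w ->
    forall x, exists2 k, (0 < k)%N & span w (x *+ k).
Proof.
move=> [[v iv] maxn]; split.
  exists (fun i => repr (v i)); apply/int_independent_quot_torsion.
  by under eq_fun do rewrite qpi_reprK.
move=> w iw x.
pose wx (i : 'I_n.+1) := if unlift ord_max i is Some j then w j else x.
have wxl j : wx (widen_ord (leqnSn n) j) = w j.
  have -> : widen_ord (leqnSn n) j = lift ord_max j.
    by apply: val_inj; rewrite /= /bump leqNgt ltn_ord.
  by rewrite /wx liftK.
have wxm : wx ord_max = x by rewrite /wx unlift_none.
have [/int_independent_quot_torsion /maxn|] := pselect (int_independent wx).
  by rewrite ltnn.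
move=> /existsNP[c /not_implyP[cwx /existsNP[i ci]]].
move: cwx; rewrite big_ord_recr /= wxm; under eq_bigr do rewrite wxl.
move=> /eqP; rewrite addr_eq0 => /eqP cwx.
have cm : c ord_max != 0.
  apply/eqP => cm; move: cwx; rewrite cm mulr0z oppr0 => /iw c0.
  case: ci; have [j ->|->] := unliftP ord_max i; last exact: cm.
  rewrite -[RHS](c0 j); congr c; apply: val_inj.
  by rewrite /= /bump leqNgt ltn_ord.
exists `|c ord_max|%N; first by rewrite absz_gt0.
have sx : span w (x *~ c ord_max).
  rewrite -[_ *~ _]opprK; apply: sgN; first exact: span_subgroup.
  by eexists; rewrite -cwx.
rewrite pmulrn; case: (ltrP (c ord_max) 0) => [lt0|ge0].
  by rewrite ltz0_abs // mulrNz; apply: sgN => //; exact: span_subgroup.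
by rewrite gez0_abs.
Qed.

End Rank.

(** * Finite ranks imply both properties *)

Section Sufficiency.
Variables (G : zmodType) (n : nat).
Hypothesis rankG : has_rank (G /s torsion_subgroup G) n.
Hypothesis finG : finite_torsion G.
Variables (H : zmodClosed G) (phi : {additive G -> G /s H}).
Hypothesis phi_inj : injective phi.

Let U (v : 'I_n -> G) : 'I_n -> G := fun i => repr (phi (v i)).

Lemma phi_span v x : span v x -> exists2 y, span (U v) y & qpi H y = phi x.
Proof.
move=> [c ->]; exists (\sum_i U v i *~ c i); first by exists c.
by rewrite !raddf_sum; apply: eq_bigr => i _; rewrite !raddfMz /= qpi_reprK.
Qed.

Lemma span_phi v y : span (U v) y -> exists2 x, span v x & qpi H y = phi x.
Proof.
move=> [c ->]; exists (\sum_i v i *~ c i); first by exists c.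
by rewrite !raddf_sum; apply: eq_bigr => i _; rewrite !raddfMz /= qpi_reprK.
Qed.

Lemma independent_mod_H v c : int_independent v ->
  qpi H (\sum_i U v i *~ c i) = 0 -> forall i, c i = 0.
Proof.
move=> iv c0; apply: iv; apply: phi_inj; rewrite raddf0 -[RHS]c0.
by rewrite !raddf_sum; apply: eq_bigr => i _; rewrite !raddfMz /= qpi_reprK.
Qed.

Lemma independent_U v : int_independent v -> int_independent (U v).
Proof.
by move=> iv c c0; apply: (independent_mod_H iv); rewrite c0 raddf0.
Qed.

(** As [phi] is injective, lifts of the [phi (v i)] form a maximal independent family whose span
    meets [H] only in 0; a positive multiple of [x] lies in both. *)
Lemma co_Bassian_torsion x : x \in H -> exists2 m, (0 < m)%N & x *+ m = 0.
Proof.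
move=> xH; have [[v iv] rk] := has_rank_span rankG.
have [m m0 [c xm]] := rk _ (independent_U iv) x; exists m => //.
have /(independent_mod_H iv) c0 : qpi H (\sum_i U v i *~ c i) = 0.
  by rewrite -xm; apply/qpi_eq0; exact: rpredMn.
by rewrite xm big1 // => i _; rewrite c0 mulr0z.
Qed.

(** Let [F] be the span of [v]. The sums [y + phi g], with [g] over the [k]-torsion of [G / F], are
    [size ys * size gs] classes of [k]-torsion modulo [phi F]. The [k]-torsion of [G / d F] bounds
    their number by [size gs * size D], and [size gs] cancels. *)
Lemma separated_image_bound : exists D : nat, forall ys : seq (G /s H),
  separated (fun y => y \in image_subgroup phi) ys -> (size ys <= D)%N.
Proof.
have [[v iv] rk] := has_rank_span rankG.
have iu := independent_U iv.
pose K x := exists y z, [/\ span (U v) y, z \in H & x = y + z].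
have sK : is_subgroup K.
  by apply: add_subgroup; [exact: span_subgroup|exact: zmodClosed_subgroup].
have KP x : K x <-> exists2 f, span v f & qpi H x = phi f.
  split=> [[y [z [/span_phi[f vf yf] zH ->]]]|[f /phi_span[y yU <-] xy]].
    by exists f => //; rewrite raddfD /= yf (proj2 (qpi_eq0 _ z) zH) addr0.
  by exists y, (x - y); split=> //; [exact/qpi_eq|rewrite addrC subrK].
have [d d0 dP] : exists2 d, (0 < d)%N & forall i, span (U v) (v i *+ d).
  have [|d d0 dP] := @exists_exponent G (span (U v)) [seq v i | i : 'I_n]
    (span_subgroup _); first by move=> x _; exact: rk iu x.
  by exists d => // i; apply: dP; exact: codom_f.
pose B := span (fun i => v i *+ d).
have sB : is_subgroup B := span_subgroup _.
have BK x : B x -> K x.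
  move=> Bx; apply/KP; have : span (U v) x.
    by apply: span_sub Bx => //; exact: span_subgroup.
  by move=> /span_phi[f vf xf]; exists f.
have finB e : (0 < e)%N -> exists t, covers (fun x => B (x *+ e)) B t.
  exact: finite_torsion_mod_span.
have ivd : int_independent (fun i => v i *+ d).
  move=> c cv0 i; have : c i *~ d%:Z = 0.
    apply: (iv (fun i => c i *~ d%:Z)); rewrite -[RHS]cv0.
    by apply: eq_bigr => j _; rewrite pmulrn -mulrzA mulrzz mulrC.
  by move/eqP; rewrite mulrzz mulf_eq0 => /orP[/eqP//|]; case: (d) d0.
(* [D] represents [F / d F] and is fixed before [ys] and [k], which makes the bound uniform. *)
have [D covD] := covers_span v d0.
exists (size D) => ys sys.
have [k k0 kP] : exists2 k, (0 < k)%N &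
    forall y, y \in [seq repr y | y <- ys] -> span (U v) (y *+ k).
  by apply: exists_exponent => [|x _]; [exact: span_subgroup|exact: rk iu x].
have [s covs] := finite_torsion_mod_span v finG k0.
have [gs [covg [ug sepg] gF]] := transversal_exists (span_subgroup _) covs.
have gs0 : (0 < size gs)%N.
  have [|g] := covg 0; last by case: (gs).
  by rewrite mul0rn; exact: sg0 (span_subgroup _).
pose z (y : G /s H) g : G := repr y + repr (phi g).
have zE y g : qpi H (z y g) = y + phi g by rewrite raddfD /= !qpi_reprK.
(* [y] is recovered modulo [phi G], then [g] modulo [F] by injectivity of [phi]. *)
have zinj y g y' g' : y \in ys -> g \in gs -> y' \in ys -> g' \in gs ->
    K (z y g - z y' g') -> (y, g) = (y', g').
  move=> yys ggs y'ys g'gs /KP[f vf].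
  rewrite raddfB /= !zE opprD addrACA -raddfB => eq_f. have eyy' : y = y'.
    apply: (proj2 sys) => //; apply/asboolP; exists (f - (g - g')).
    by rewrite raddfB -eq_f addrK.
  move: eq_f; rewrite eyy' subrr add0r => /phi_inj eq_f; congr pair.
  by apply: sepg => //; rewrite eq_f.
have [t szt covt] : exists2 t, (size t <= size gs * size D)%N &
    covers (fun x => B (x *+ k)) B t.
  pose t := [seq g + e | g <- gs, e <- D].
  have -> : (size gs * size D)%N = size t by rewrite size_allpairs.
  apply: (covers_sub sB (Q := fun x => span v (x *+ k))).
    exact: covers_trans covg covD.
  move=> x; apply: span_sub; first exact: span_subgroup.
  by move=> i; apply: sgMn; [exact: span_subgroup|exact: mem_span].
suff : (size ys * size gs <= size gs * size D)%N.
  by rewrite mulnC leq_pmul2l.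
apply: leq_trans szt; rewrite -(size_allpairs z).
apply: (separated_size_torsion (L := fun x => K (x *+ k)) _ sK sB BK)
  covt => //.
- exact: mulrn_preim_subgroup.
- move=> _ /allpairsP[[y g] /= [yys ggs ->]]; apply/KP.
  have /span_phi[f vf yf] := kP _ (map_f _ yys).
  exists (f + g *+ k); first by apply: sgD; [exact: span_subgroup| |exact: gF].
  by rewrite raddfMn /= zE mulrnDl raddfD -yf !raddfMn /= qpi_reprK.
- by move=> x _; exact: rk ivd x.
- split.
    apply: allpairs_uniq => //; first by case: sys.
    move=> [a b] [e f] /allpairsP[[a' b'] /= [a_s b_y [-> ->]]].
    move=> /allpairsP[[c' d'] /= [c_s d_y [-> ->]]] eq_abcd.
    by apply: zinj => //; rewrite eq_abcd subrr; exact: sg0.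
  move=> x x' /allpairsP[[a b] /= [a_s b_y ->]].
  move=> /allpairsP[[e f] /= [c_s d_y ->]].
  by move=> /(zinj _ _ _ _ a_s b_y c_s d_y)[-> ->].
Qed.

Lemma image_finite_index : finite_index (image_subgroup phi).
Proof.
have [D maxD] := separated_image_bound.
apply: contrapT => inf.
suff sep N : exists2 ys, size ys = N &
    separated (fun y => y \in image_subgroup phi) ys.
  by have [ys szy /maxD] := sep D.+1; rewrite szy ltnn.
elim: N => [|N [ys szy [uys sys]]]; first by exists [::].
have [y yP] : exists y, forall z, z \in ys -> y - z \notin image_subgroup phi.
  apply: contrapT => /forallNP ny; apply: inf; apply/finite_seqP.
  exists [seq qpi (image_subgroup phi) y | y <- ys].
  apply/seteqP; split=> // q _ /=.
  have /existsNP[z /not_implyP[zy /negP/negPn qz]] := ny (repr q).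
  by apply/mapP; exists z => //; rewrite -[LHS]qpi_reprK; exact/qpi_eq.
exists (y :: ys); first by rewrite /= szy.
split=> [|a b].
  rewrite /= uys andbT; apply/negP => /yP.
  by rewrite subrr rpred0.
rewrite !in_cons => /orP[/eqP->|ay] /orP[/eqP->|bys] //; last exact: sys.
  by rewrite (negPf (yP _ bys)).
by rewrite -opprB rpredN (negPf (yP _ ay)).
Qed.

(** Otherwise [x] and the images of the [p]-torsion of [G] are one class too many for the torsion
    count with [K = H] and [B = 0]. The count applies because [H] is torsion, so that the lifts of
    these classes are torsion too. *)
Lemma prime_torsion_in_image p (x : G /s H) : prime p -> x *+ p = 0 ->
  x \in image_subgroup phi.
Proof.
move=> p_pr xp; apply: contrapT => /negP nx.
have [s covs] := finG (prime_gt0 p_pr).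
have [gs [covg [ug sepg] gp]] := transversal_exists (trivial_subgroup G) covs.
suff : (size (repr x :: [seq repr (phi g) | g <- gs]) <= size gs)%N.
  by rewrite /= size_map ltnn.
have inH (z : G) : z *+ p \in H <-> qpi H z *+ p = 0.
  by rewrite -raddfMn; split=> [zp|zp]; exact/qpi_eq0.
have elem z : z \in repr x :: [seq repr (phi g) | g <- gs] -> z *+ p \in H.
  rewrite in_cons => /orP[/eqP->|/mapP[g gg ->]]; apply/inH;
    rewrite qpi_reprK //.
  by rewrite -raddfMn gp // raddf0.
apply: (separated_size_torsion (L := fun z => z *+ p \in H)
  (K := fun z => z \in H) (B := eq^~ 0) (m := p)) => //.
- apply: (mulrn_preim_subgroup (P := fun z => z \in H)).
  exact: zmodClosed_subgroup.
- exact: zmodClosed_subgroup.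
- exact: trivial_subgroup.
- by move=> z ->; exact: rpred0.
- move=> z /elem /co_Bassian_torsion[m m0 zpm].
  exists (p * m)%N; first by rewrite muln_gt0 prime_gt0.
  by rewrite /= mulrnA.
have sep a b : a \in gs -> b \in gs ->
    repr (phi a) - repr (phi b) \in H -> a = b.
  by move=> ag bg /qpi_eq; rewrite !qpi_reprK => /phi_inj.
have nsep a : repr x - repr (phi a) \notin H.
  apply/negP => /qpi_eq; rewrite !qpi_reprK => xa.
  by case/negP: nx; apply/asboolP; exists a.
split=> [|a b].
  rewrite /= map_inj_in_uniq ?ug ?andbT => [|a b ag bg ab].
    by apply/mapP => -[a ag xa]; have := nsep a; rewrite xa subrr rpred0.
  by apply: sep => //; rewrite ab subrr rpred0.
rewrite !in_cons => /orP[/eqP->|/mapP[c cg ->]] /orP[/eqP->|/mapP[d dg ->]] //.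
- by rewrite (negPf (nsep _)).
- by rewrite -opprB rpredN (negPf (nsep _)).
- by move/sep => ->.
Qed.

(** A torsion [x] has a multiple of prime order, which is in the image; otherwise a positive
    multiple of [x], necessarily non-zero, lies in the image of the span of [v]. *)
Lemma image_essential : essential (image_subgroup phi).
Proof.
move=> S [x xS x0].
have [[k k0 xk]|ntors] := pselect (exists2 k, (0 < k)%N & x *+ k = 0).
  suff [y [yS y0 [p p_pr yp]]] : exists y, [/\ y \in S, y != 0 &
      exists2 p, prime p & y *+ p = 0].
    by exists y; split=> //; exact: prime_torsion_in_image yp.
  elim/ltn_ind: k k0 x xS x0 xk => k IHk k0 x xS x0 xk.
  have k1 : (1 < k)%N.
    rewrite ltn_neqAle k0 andbT; apply/eqP => k1.
    by case/eqP: x0; rewrite -xk -k1.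
  have p_pr := pdiv_prime k1; have [q kE] := dvdnP (pdiv_dvd k).
  set p := pdiv k in p_pr kE.
  have [xp|xp] := eqVneq (x *+ p) 0; first by exists x; split=> //; exists p.
  apply: (IHk q) xp _; last by rewrite -mulrnA mulnC -kE.
  - rewrite kE ltn_Pmulr ?prime_gt1 //.
    by move: k0; rewrite kE muln_gt0 => /andP[].
  - by move: k0; rewrite kE muln_gt0 => /andP[].
  - exact: rpredMn.
have [[v iv] rk] := has_rank_span rankG.
have [k k0 /span_phi[f _ xf]] := rk _ (independent_U iv) (repr x).
have xfk : x *+ k = phi f by rewrite -xf raddfMn /= qpi_reprK.
exists (x *+ k); split; first by apply/asboolP; exists f.
  exact: rpredMn.
by apply/eqP => xk; case: ntors; exists k.
Qed.

End Sufficiency.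

(** * Finite [p]-rank as finiteness of the [p]-torsion *)

Section SocleDimension.
Variables (p : nat) (pr_p : prime p) (G : zmodType).
Local Notation V := (socle pr_p G).

Lemma primary_socleE (x : G) : (x \in @primary_socle p G) = (x *+ p == 0).
Proof.
rewrite /in_mem /= /primary_socle andb_idl // => /eqP xp.
apply/andP; split; last by apply/asboolP; exists 1%N.
by apply/asboolP; exists p; rewrite ?prime_gt0.
Qed.

Lemma finite_p_rank_covers : finite_p_rank pr_p G ->
  exists t, covers (fun x : G => x *+ p = 0) (eq^~ 0) t.
Proof.
move=> [n [f [g fK gK]]].
exists [seq val (g r) | r : 'rV['F_p]_n] => x xp.
have xS : x \in @primary_socle p G by rewrite primary_socleE xp.
exists x; last by rewrite subrr.
by apply/mapP; exists (f (Socle pr_p xS)); rewrite ?mem_enum // fK.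
Qed.

(** If the socle has no finite dimension, an injective linear map from F_p^n misses a vector, and
    adjoining it raises n. With n the size of [t], this gives p^n > n socle elements, too many for
    [t]. *)
Lemma covers_finite_p_rank t : covers (fun x : G => x *+ p = 0) (eq^~ 0) t ->
  finite_p_rank pr_p G.
Proof.
move=> covt; apply: contrapT => inf.
have grow n : exists f : 'rV['F_p]_n -> V, linear f /\ injective f.
  elim: n => [|n [f [lf fI]]].
    exists (fun=> 0); split=> [a u v|u v _]; first by rewrite scaler0 addr0.
    by rewrite [u]thinmx0 [v]thinmx0.
  have f0 : f 0 = 0.
    by have := lf (-1) 0 0; rewrite scaler0 addr0 scaleN1r addNr.
  have fD u v : f (u + v) = f u + f v by have := lf 1 u v; rewrite !scale1r.
  have fZ a u : f (a *: u) = a *: f u by have := lf a u 0; rewrite f0 !addr0.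
  have fN u : f (- u) = - f u by rewrite -!scaleN1r fZ.
  have [x nx] : exists x, forall u, f u != x.
    apply: contrapT => /forallNP surj; apply: inf; exists n.
    have /choice[g gK] y : exists u, f u = y.
      by have /existsNP[u /negP/negPn/eqP] := surj y; exists u.
    have gK' : cancel f g by move=> u; exact/fI/gK.
    have lg : linear g.
      by move=> a y z; apply: fI; rewrite fD fZ !gK.
    pose lg' := GRing.isLinear.Build _ _ _ _ g lg.
    pose g' : {linear V -> 'rV['F_p]_n} := HB.pack g lg'.
    by exists g'; exists f.
  pose hd (u : 'rV['F_p]_n.+1) := @lsubmx _ 1 1 n u 0 0.
  pose tl (u : 'rV['F_p]_n.+1) := @rsubmx _ 1 1 n u.
  exists (fun u => hd u *: x + f (tl u)); split.
    move=> a u v; have -> : hd (a *: u + v) = a * hd u + hd v.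
      by rewrite /hd linearP !mxE.
    by rewrite /tl linearP fD fZ scalerDl scalerDr -scalerA addrACA.
  move=> u v /= eq_uv; rewrite -(@hsubmxK _ 1 1 n u) -(@hsubmxK _ 1 1 n v).
  move: eq_uv; have [eq_a|neq_a] := eqVneq (hd u) (hd v).
    rewrite eq_a => /addrI /fI eq_tl.
    have -> : @rsubmx _ 1 1 n u = @rsubmx _ 1 1 n v := eq_tl.
    have -> // : @lsubmx _ 1 1 n u = @lsubmx _ 1 1 n v.
    by apply/matrixP => i j; rewrite !ord1.
  move=> /eqP; rewrite -subr_eq0 opprD addrACA -scalerBl -fN -fD addr_eq0.
  move=> /eqP eq_x; case/eqP: (nx (- ((hd u - hd v)^-1 *: (tl u - tl v)))).
  rewrite -scalerN fZ fN -eq_x scalerA mulVf ?scale1r //.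
  by rewrite subr_eq0.
have [f [_ fI]] := grow (size t).
have : (size [seq val (f r) | r : 'rV['F_p]_(size t)] <= size t)%N.
  apply: uniq_leq_size.
    by rewrite map_inj_uniq ?enum_uniq // => u v /val_inj/fI.
  move=> _ /mapP[r _ ->]; have [|y yt] := covt (val (f r)).
    by apply/eqP; rewrite -primary_socleE; exact: valP.
  by move=> /eqP; rewrite subr_eq0 => /eqP->.
rewrite size_map -cardE card_mx mul1n card_Fp // leqNgt.
by rewrite ltn_expl // prime_gt1.
Qed.

End SocleDimension.

(** * Bounding the torsion-free rank by a finite family *)

Lemma int_system_solution m n (M : 'I_m -> 'I_n -> int) : (n < m)%N ->
  exists2 b : 'I_m -> int, exists j, b j != 0 &
    forall k, \sum_j b j * M j k = 0.
Proof.
move=> ltnm; pose A : 'M[rat]_(m, n) := \matrix_(j, k) (M j k)%:~R.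
have : kermx A != 0.
  rewrite kermx_eq0 /row_free; apply/eqP => rA.
  by have := rank_leq_col A; rewrite rA leqNgt ltnm.
move=> /rowV0Pn[r /sub_kermxP rA r0].
(* Denominators are cleared by reading the kernel row as a rational polynomial. *)
have [q [a a0 rq]] := rat_poly_scale (rVpoly r).
have rE j : r 0 j = a%:~R^-1 * (q`_j)%:~R.
  by rewrite -coef_rVpoly_ord rq coefZ coef_map.
have aU : (a%:~R : rat)^-1 != 0 by rewrite invr_eq0 intr_eq0.
exists (fun j => q`_j).
  apply: contrapT => /forallNP q0; case/eqP: r0; apply/rowP => j.
  have /negP/negPn/eqP qj := q0 j.
  by rewrite rE qj mulr0 mxE.
move=> k; apply: (@intr_inj rat); apply: (mulfI aU).
have := congr1 (fun B : 'M_(1, n) => B 0 k) rA; rewrite !mxE mulr0 => <-.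
rewrite rmorph_sum mulr_sumr; apply: eq_bigr => j _.
by rewrite rE !mxE rmorphM mulrA.
Qed.

Lemma bounded_has_rank (A : zmodType) N :
  (forall m (v : 'I_m -> A), int_independent v -> (m <= N)%N) ->
  exists n, has_rank A n.
Proof.
move=> maxN; pose P m := `[< exists v : 'I_m -> A, int_independent v >].
have exP : exists m, P m.
  by exists 0%N; apply/asboolP; exists (fun=> 0) => c _ [].
have leP m : P m -> (m <= N)%N by move=> /asboolP[v]; exact: maxN.
case: (ex_maxnP exP leP) => n /asboolP Pn maxn; exists n; split=> // m v iv.
by apply: maxn; apply/asboolP; exists v.
Qed.

(** Given [m > n] elements with multiples in the span of [e], a relation between these multiples is
    a system of [n] equations in [m] unknowns, which has a non-zero integer solution. *)
Lemma span_finite_rank (G : zmodType) n (e : 'I_n -> G) :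
  (forall x, exists2 c : int, c != 0 & span e (x *~ c)) ->
  finite_torsion_free_rank G.
Proof.
move=> dep; apply: (@bounded_has_rank _ n) => m v iv; rewrite leqNgt.
apply/negP => ltnm.
have iw : int_independent (fun i => repr (v i)).
  by apply/int_independent_quot_torsion; under eq_fun do rewrite qpi_reprK.
have /choice[c cP] j : exists c : int, c != 0 /\ span e (repr (v j) *~ c).
  by have [c] := dep (repr (v j)); exists c.
have /choice[M MP] j : exists a, repr (v j) *~ c j = \sum_k e k *~ a k.
  by have [_ [a]] := cP j; exists a.
have [b [j bj] bM] := int_system_solution M ltnm.
have /iw/(_ j)/eqP : \sum_i repr (v i) *~ (c i * b i) = 0.
  under eq_bigr => i _.
    rewrite mulrzA MP mulrz_suml; under eq_bigr do rewrite -mulrzA mulrC.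
    over.
  rewrite exchange_big big1 // => k _.
  by rewrite -mulrz_sumr bM mulr0z.
by rewrite mulf_eq0 (negPf bj) orbF (negPf (proj1 (cP j))).
Qed.

(** * Extending homomorphisms by Baer's criterion *)

(** Extension from the ideal generated by [m] in Z / q: the value [z] at [m] is killed by [q / m]
    and has to be [m] times a value at 1. For [q = 0] the condition on [z] is void, as
    [0 %/ m = 0]. *)
Definition bounded_injective (q : nat) (W : zmodType) : Prop :=
  forall m (z : W), (0 < m)%N -> (m %| q)%N -> z *+ (q %/ m) = 0 ->
    exists y, y *+ m = z.

Section Extension.
Variables (G W : zmodType) (q : nat).

(** Graph of a homomorphism from a subgroup of [G] to [W]; for a subgroup, single-valuedness at 0
    suffices. *)
Definition functional_subgroup (R : G * W -> Prop) : Prop :=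
  is_subgroup R /\ forall w, R (0, w) -> w = 0.

Lemma functional_subgroup_maximal (R0 : G * W -> Prop) :
  functional_subgroup R0 ->
  exists R, [/\ functional_subgroup R, forall x, R0 x -> R x &
    forall R', functional_subgroup R' -> (forall x, R x -> R' x) ->
      forall x, R' x -> R x].
Proof.
move=> fR0.
(* Zorn is applied to sets added to [R0], so that the empty chain is bounded too. *)
have [F FP tF|A [PA maxA]] := @Zorn_bigcup (G * W)%type
    (fun X => functional_subgroup (fun x => R0 x \/ X x)).
  set B := (\bigcup_(X in F) X)%classic.
  have common x y : R0 x \/ B x -> R0 y \/ B y -> exists X,
      [/\ functional_subgroup (fun x => R0 x \/ X x), R0 x \/ X x,
        R0 y \/ X y & forall z, R0 z \/ X z -> R0 z \/ B z].
    have inB X : F X -> forall z, R0 z \/ X z -> R0 z \/ B z.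
      by move=> FX z [|Xz]; [left|right; exists X].
    move=> [R0x|[X FX Xx]] [R0y|[Y FY Yy]].
    - exists set0; split; [|by left|by left|by move=> z [|[]]; left].
      have -> // : (fun x => R0 x \/ set0 x) = R0.
      by apply/funext => z; apply/propext; split=> [[|[]]//|]; left.
    - by exists Y; split; [exact: FP|left|right|exact: inB].
    - by exists X; split; [exact: FP|right|left|exact: inB].
    - have [XY|YX] := tF _ _ FX FY.
        by exists Y; split; [exact: FP|right; exact: XY|right|exact: inB].
      by exists X; split; [exact: FP|right|right; exact: YX|exact: inB].
  split; [split=> [|x y Bx By]|].
  - by left; exact: sg0 (proj1 fR0).
  - have [X [[sX _] Xx Xy XB]] := common x y Bx By.
    by apply: XB; exact: (sgB sX Xx Xy).
  - move=> w Bw; have [X [[_ fX] Xx _ _]] := common _ _ Bw Bw.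
    exact: (fX w Xx).
exists (fun x => R0 x \/ A x); split=> // [x|R' fR' AR' x R'x]; first by left.
apply: contrapT => nx; refine (maxA R' _ _).
  split=> [y Ay|R'A]; first by apply: AR'; right.
  by apply: nx; right; exact: R'A.
have -> // : (fun y => R0 y \/ R' y) = R'.
apply/funext => y; apply/propext; split=> [[R0y|//]|]; last by right.
by apply: AR'; left.
Qed.

Lemma pair_sgB (R : G * W -> Prop) g w g' w' : is_subgroup R ->
  R (g, w) -> R (g', w') -> R (g - g', w - w').
Proof. by move=> sR Rg Rg'; exact: (sgB sR Rg Rg'). Qed.

Lemma pair_sgMz (R : G * W -> Prop) g w j : is_subgroup R ->
  R (g, w) -> R (g *~ j, w *~ j).
Proof.
move=> sR /(sgMz sR j); rewrite [_ *~ j]surjective_pairing.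
by rewrite (raddfMz fst) (raddfMz snd).
Qed.

Lemma functional_subgroup_eq R g w w' : functional_subgroup R ->
  R (g, w) -> R (g, w') -> w = w'.
Proof.
move=> [sR fR] Rw Rw'; apply/eqP; rewrite -subr_eq0; apply/eqP/fR.
by rewrite -(subrr g); exact: pair_sgB.
Qed.

(* Baer's criterion, where [q = 0] is divisibility and [q > 0] is injectivity
   among the groups of exponent [q]. *)
Lemma extend_additive (R0 : G * W -> Prop) :
  bounded_injective q W -> functional_subgroup R0 ->
  (forall g, R0 (g *+ q, 0)) ->
  exists f : {additive G -> W}, forall g w, R0 (g, w) -> f g = w.
Proof.
move=> injW fR0 qR0.
have [R [fR R0R maxR]] := functional_subgroup_maximal fR0.
have [sR _] := fR.
have total x : exists w, R (x, w).
  pose dom j := exists w, R (x *~ j, w).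
  have dom0 : dom 0 by exists 0; rewrite mulr0z; exact: sg0 sR.
  have sdom : is_subgroup dom.
    split=> // j k [w jw] [w' kw']; exists (w - w'); rewrite mulrzBr.
    exact: (pair_sgB sR jw kw').
  (* By maximality it suffices to find a value [y] at [x] that agrees with [R] on all multiples of
     [x]. *)
  suff [y yP] : exists y, forall j w, R (x *~ j, w) -> w = y *~ j.
    pose R' gw := exists j : int, R (gw.1 - x *~ j, gw.2 - y *~ j).
    exists y; apply: (maxR R').
    - split; [split|].
      + by exists 0; rewrite !mulr0z !subr0; exact: sg0 sR.
      + move=> [g w] [g' w'] [j /= Rj] [j' /= Rj']; exists (j - j') => /=.
        have := pair_sgB sR Rj Rj'.
        by rewrite !mulrzBr subrACA (subrACA w).
      + move=> w [j] /=; rewrite sub0r -mulrNz => /yP /eqP.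
        by rewrite mulrNz -subr_eq0 opprK subrK => /eqP.
    - by move=> [g w] Rgw; exists 0; rewrite /= !mulr0z !subr0.
    - by exists 1; rewrite /= !mulr1z !subrr; exact: sg0 sR.
  (* [dom] is an ideal of the integers: either zero, and [y = 0] works, or generated by its least
     positive element [m]. *)
  have [pos|npos] :=
      pselect (exists m : nat, (0 < m)%N && `[< dom m >]); last first.
    exists 0 => j w Rjw; rewrite mul0rz.
    suff j0 : j = 0 by apply: (proj2 fR); rewrite -(mulr0z x) -j0.
    apply: contrapT => /eqP j0; case: npos; exists `|j|%N.
    rewrite absz_gt0 j0; apply/asboolP; rewrite abszE /=.
    have dj : dom j by exists w.
    by case: ger0P => _ //; exact: (sgN sdom).
  case: (ex_minnP pos) => m /andP[m0 /asboolP[z Rz]] minm.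
  have mdom j : dom j -> (m %| j)%Z.
    move=> dj; have : dom (j %% m)%Z.
      rewrite /modz; apply: sgB => //.
      by rewrite mulrC -mulrzz; apply: sgMz => //; exists z.
    have r0 : 0 <= (j %% m)%Z by apply: modz_ge0; rewrite eqz_nat -lt0n.
    rewrite -(gez0_abs r0) => dr; apply/dvdz_mod0P; rewrite -(gez0_abs r0).
    congr Posz; apply/eqP; rewrite -leqn0 leqNgt; apply/negP => rpos.
    have := minm `|(j %% m)%Z|%N; rewrite rpos (asboolT dr) => /(_ isT).
    by rewrite leqNgt -ltz_nat gez0_abs // ltz_pmod.
  (* [R0] sends [x *+ q] to 0, so [q] is in [dom]; this also makes [q %/ m] kill [z] below. *)
  have mq : (m %| q)%N.
    by apply: (mdom q); exists 0; rewrite -pmulrn; exact: R0R.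
  have [|y yz] := injW m z m0 mq.
    have Rq0 : R (x *+ q, 0) by exact: R0R.
    apply: (functional_subgroup_eq fR _ Rq0).
    have := pair_sgMz (q %/ m)%N sR Rz.
    by rewrite -mulrzA -PoszM mulnC divnK // -!pmulrn.
  exists y => j w Rjw; have /dvdzP[k jE] : (m %| j)%Z by apply: mdom; exists w.
  apply: (functional_subgroup_eq fR Rjw).
  by rewrite jE mulrC !mulrzA -(pmulrn y) yz; exact: pair_sgMz.
have /choice[f fP] := total.
have fB : zmod_morphism f.
  move=> g h; apply: (functional_subgroup_eq fR (fP _)).
  exact: (pair_sgB sR (fP g) (fP h)).
pose fB' := GRing.isZmodMorphism.Build _ _ f fB.
pose f' : {additive G -> W} := HB.pack f fB'.
exists f' => g w R0gw; exact: (functional_subgroup_eq fR (fP g) (R0R _ R0gw)).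
Qed.

End Extension.

(** * Integer combinations and direct families *)

Section Combinations.
Variable A : zmodType.
Implicit Types (e : nat -> A) (c : {poly int}).

(* Finitely supported integer families are encoded as integer polynomials. *)
Definition comb e c : A := \sum_(i < size c) e i *~ c`_i.

Lemma comb_widen e c n : (size c <= n)%N -> comb e c = \sum_(i < n) e i *~ c`_i.
Proof.
move=> szc; rewrite -(subnKC szc) big_split_ord /= -[LHS]addr0; congr (_ + _).
rewrite big1 // => i _.
by rewrite nth_default ?mulr0z // leq_addr.
Qed.

Lemma comb_is_zmod_morphism e : zmod_morphism (comb e).
Proof.
move=> c d; pose n := maxn (size c) (size d).
rewrite !(@comb_widen _ _ n) ?leq_maxl ?leq_maxr //; last first.
  by rewrite (leq_trans (size_polyD _ _)) // size_polyN.
rewrite -sumrB; apply: eq_bigr => i _.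
by rewrite coefB mulrzBr.
Qed.

HB.instance Definition _ e :=
  GRing.isZmodMorphism.Build {poly int} A (comb e) (comb_is_zmod_morphism e).

Lemma combXn e n : comb e 'X^n = e n.
Proof.
rewrite /comb size_polyXn big_ord_recr /= coefXn eqxx mulr1z big1 ?add0r //.
by move=> i _; rewrite coefXn ltn_eqF ?ltn_ord // mulr0z.
Qed.

Lemma comb_annihilated e c (o : nat -> nat) :
  (forall i, e i *+ o i = 0) -> (forall i, (o i %| c`_i)%Z) -> comb e c = 0.
Proof.
move=> eo oc; rewrite /comb big1 // => i _.
have /dvdzP[k ->] := oc i.
by rewrite mulrC mulrzA -pmulrn eo mul0rz.
Qed.

End Combinations.

Lemma raddf_comb (A B : zmodType) (f : {additive A -> B}) e c :
  f (comb e c) = comb (f \o e) c.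
Proof.
by rewrite raddf_sum; apply: eq_bigr => i _; rewrite raddfMz.
Qed.

(* [e i] has order [o i] (infinite when [o i = 0]), and the sum of the [<e i>]
   is direct and stays so modulo [q G]. *)
Definition direct_mod (A : zmodType) (q : nat) (o : nat -> nat)
    (e : nat -> A) : Prop :=
  (forall i, e i *+ o i = 0) /\
  forall c h, comb e c = h *+ q -> forall i, (o i %| c`_i)%Z.

Lemma direct_modS (A : zmodType) q o (e : nat -> A) c :
  direct_mod q o e -> comb e c = 0 -> forall i, (o i %| c`_i)%Z.
Proof. by move=> [_ eq_e] c0; apply: (eq_e c 0); rewrite mul0rn. Qed.

(** Sending [e i] to [u i] and [q G] to 0 is well defined, because a combination of [e] lying in
    [q G] has coefficients divisible by the [o i], which kill the [u i]. *)
Lemma extend_comb (G W : zmodType) q o (e : nat -> G) (u : nat -> W) :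
  bounded_injective q W -> direct_mod q o e -> (forall i, u i *+ o i = 0) ->
  exists f : {additive G -> W}, forall c, f (comb e c) = comb u c.
Proof.
move=> injW [eo ie] uo.
pose R0 (x : G * W) := exists c h, x = (comb e c + h *+ q, comb u c).
have [|g|f fR] := @extend_additive G W q R0 injW.
- split; last first.
    move=> w [c [h [/esym/eqP ch ->]]]; apply: comb_annihilated uo _ => i.
    by apply: (ie c (- h)); move: ch; rewrite addr_eq0 mulNrn => /eqP.
  split=> [|_ _ [c [h ->]] [d [k ->]]].
    by exists 0, 0; rewrite !raddf0 mul0rn addr0.
  by exists (c - d), (h - k); rewrite !raddfB mulrnBl addrACA -opprD.
- by exists 0, g; rewrite !raddf0 add0r.
- by exists f => c; apply: fR; exists c, 0; rewrite mul0rn addr0.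
Qed.

(** * Embedding [G] beside a copy of [W] in a quotient of [G] *)

Section Doubling.
Variables (G W : zmodType) (q : nat) (o : nat -> nat) (e : nat -> G).
Variables (w : nat -> W) (u : nat -> W * W).
Hypothesis injW : bounded_injective q W.
Hypothesis de : direct_mod q o e.
Hypothesis dw : direct_mod 0 o w.
Hypothesis o1 : forall i, o i != 1%N.
Hypothesis uo : forall i, u i *+ o i = 0.
Hypothesis u_surj : forall z, exists i, u i = z.

Lemma bounded_injective_pair : bounded_injective q (W * W)%type.
Proof.
move=> m [z z'] m0 mq zq.
have [|y yz] := injW m0 mq (z := z).
  by rewrite -[LHS](raddfMn fst _ (z, z')) zq.
have [|y' yz'] := injW m0 mq (z := z').
  by rewrite -[LHS](raddfMn snd _ (z, z')) zq.
exists (y, y'); rewrite [LHS]surjective_pairing.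
by rewrite (raddfMn fst) (raddfMn snd) /= yz yz'.
Qed.

(* If [s] extends [e i |-> u i] and [f] extends [e i |-> w i], the quotient of
   [G] by the kernel of [s] on [<e>] is [G / <e> * W * W], and [G] embeds in
   [G / <e> * W * 0] because [f] is injective on [<e>]. *)
Lemma doubling_embedding : exists (H : zmodClosed G)
    (phi : {additive G -> G /s H}) (psi : {additive W -> G /s H}),
  injective phi /\
    forall a, psi a \in image_subgroup phi -> a = 0.
Proof.
have [f fe] := extend_comb injW de (proj1 dw).
have [s se] := extend_comb bounded_injective_pair de uo.
pose F x := exists c, x = comb e c.
have sF : is_subgroup F.
  split=> [|_ _ [c ->] [d ->]]; first by exists 0; rewrite raddf0.
  by exists (c - d); rewrite raddfB.
have sF_surj z : exists2 x, F x & s x = z.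
  have [i <-] := u_surj z; exists (comb e 'X^i); first by exists 'X^i.
  by rewrite se combXn.
have fF_inj x : F x -> f x = 0 -> x = 0.
  move=> [c ->]; rewrite fe => /(direct_modS dw); apply: comb_annihilated.
  by case: de.
pose K x := F x /\ s x = 0.
have sK : is_subgroup K.
  by apply: and_subgroup => //; exact: preim_subgroup (trivial_subgroup _).
pose H := subgroup_of sK.
(* Modulo [H] the correction [p g] is determined by its value under [s], so an arbitrary choice
   still yields an additive map. *)
have /choice[p pP] g : exists x, F x /\ s (g + x) = (f g, 0).
  have [x Fx sx] := sF_surj ((f g, 0) - s g); exists x.
  by rewrite raddfD sx addrC subrK.
pose phi0 g := qpi H (g + p g).
have phi0B : zmod_morphism phi0.
  move=> a b; rewrite /phi0 -raddfB; apply/qpi_eq/subgroup_ofE.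
  have -> : a - b + p (a - b) - (a + p a - (b + p b)) = p (a - b) - (p a - p b).
    have -> : a + p a - (b + p b) = a - b + (p a - p b).
      by rewrite opprD addrACA.
    by rewrite opprD addrACA subrr add0r.
  split; first by apply: sgB => //; [exact: (proj1 (pP _))|
    apply: sgB => //; exact: (proj1 (pP _))].
  have sp x : s (p x) = (f x, 0) - s x.
    by rewrite -(proj2 (pP x)) raddfD addrC addKr.
  have fab : (f (a - b), 0) = (f a, 0) - (f b, 0) :> W * W.
    by rewrite raddfB [RHS]surjective_pairing /= subr0.
  by rewrite !(raddfB s) !sp fab (raddfB s) (subrACA (f a, 0)) subrr.
pose phi0' := GRing.isZmodMorphism.Build _ _ phi0 phi0B.
pose phi : {additive G -> G /s H} := HB.pack phi0 phi0'.
have /choice[g gP] b : exists x, F x /\ s x = (0, b).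
  by have [x Fx sx] := sF_surj (0, b); exists x.
pose psi0 b := qpi H (g b).
have psi0B : zmod_morphism psi0.
  move=> a b; rewrite /psi0 -raddfB; apply/qpi_eq/subgroup_ofE; split.
    by do 2![apply: sgB => //; try exact: (proj1 (gP _))].
  rewrite !(raddfB s) !(proj2 (gP _)) -[X in _ - X]/(0 - 0, a - b) subr0.
  exact: subrr.
pose psi0' := GRing.isZmodMorphism.Build _ _ psi0 psi0B.
pose psi : {additive W -> G /s H} := HB.pack psi0 psi0'.
exists H, phi, psi; split.
  apply: raddf_inj => x /qpi_eq0/subgroup_ofE[Fpx].
  rewrite (proj2 (pP x)) => -[fx0]; apply: fF_inj => //.
  by rewrite -(addrK (p x) x); apply: sgB => //; exact: (proj1 (pP _)).
move=> b /asboolP[x /qpi_eq/subgroup_ofE[_]].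
rewrite raddfB (proj2 (gP _)) (proj2 (pP _)) => -[_ /eqP].
by rewrite sub0r oppr_eq0 => /eqP.
Qed.

Lemma w_inj : injective w.
Proof.
move=> i j wij; apply: contrapT => /eqP nij; case/eqP: (o1 i).
have c0 : comb w ('X^i - 'X^j) = 0 by rewrite raddfB /= !combXn wij subrr.
have := direct_modS dw c0 i; rewrite coefB !coefXn eqxx (negPf nij) subr0.
by rewrite dvdz1 => /eqP.
Qed.

(** The [psi (w i)] are pairwise incongruent modulo the image of [phi], as [w] is injective. *)
Lemma doubling_not_finitely_co_Bassian : ~ finitely_co_Bassian G.
Proof.
have [H [phi [psi [phi_inj psi_sep]]]] := doubling_embedding.
move=> /(_ H phi phi_inj)/finite_seqP[t tP].
pose r i := qpi (image_subgroup phi) (psi (w i)).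
have r_inj : injective r.
  move=> i j /qpi_eq; rewrite -raddfB => /psi_sep/eqP.
  by rewrite subr_eq0 => /eqP/w_inj.
suff : (size [seq r i | i <- iota 0 (size t).+1] <= size t)%N.
  by rewrite size_map size_iota ltnn.
apply: uniq_leq_size; first by rewrite map_inj_uniq ?iota_uniq.
by move=> x _; have : [set` t]%classic x by rewrite -tP.
Qed.

Lemma doubling_not_semi_co_Bassian : ~ semi_co_Bassian G.
Proof.
have [H [phi [psi [phi_inj psi_sep]]]] := doubling_embedding.
move=> /(_ H phi phi_inj (image_subgroup psi))[|x [xphi /asboolP[a ax] x0]].
  have [a a0] : exists a : W, a != 0.
    exists (w 0%N - w 1%N); rewrite subr_eq0.
    by apply/eqP => /w_inj.
  exists (psi a); first by apply/asboolP; exists a.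
  apply: contra_neq a0 => psia0; apply: psi_sep; rewrite psia0.
  exact: rpred0.
by case/eqP: x0; rewrite -ax (psi_sep a) ?raddf0 ?ax.
Qed.

End Doubling.

(** * Greedy choice of direct families, and enumeration of targets *)

(** Each term is chosen against the span of the earlier ones and [q G]. In a relation the last
    coefficient is then divisible by its [o n], so the last term vanishes and the relation gets
    shorter. *)
Lemma direct_mod_greedy (A : zmodType) q (o : nat -> nat) :
  (forall n (s : nat -> A), (forall i, (i < n)%N -> s i *+ o i = 0) ->
    exists2 x, x *+ o n = 0 & forall c y h,
      span (fun i : 'I_n => s i) y -> x *~ c = y + h *+ q -> (o n %| c)%Z) ->
  exists e : nat -> A, direct_mod q o e.
Proof.
move=> step.
pose Q n (s : nat -> A) x := x *+ o n = 0 /\ forall c y h,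
  span (fun i : 'I_n => s i) y -> x *~ c = y + h *+ q -> (o n %| c)%Z.
have /choice[f fP] (ns : nat * (nat -> A)) : exists x,
    (forall i, (i < ns.1)%N -> ns.2 i *+ o i = 0) -> Q ns.1 ns.2 x.
  case: ns => n s /=.
  have [tors|ntors] := pselect (forall i, (i < n)%N -> s i *+ o i = 0).
    by have [x xo xs] := step n s tors; exists x.
  by exists 0.
pose S := fix S n :=
  if n is n'.+1 then rcons (S n') (f (n', nth 0 (S n'))) else [::].
pose e n := f (n, nth 0 (S n)).
have SE n : S n = mkseq e n by elim: n => //= n IHn; rewrite mkseqS -IHn.
have eQ n : Q n e (e n).
  elim/ltn_ind: n => n IHn.
  have Se i : (i < n)%N -> nth 0 (S n) i = e i.
    by move=> lt_in; rewrite SE nth_mkseq.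
  have [|eo es] := fP (n, nth 0 (S n)).
    by move=> i /= lt_in; rewrite Se //; case: (IHn i lt_in).
  have eS : (fun i : 'I_n => e i) = (fun i : 'I_n => nth 0 (S n) i).
    by apply/funext => i; rewrite Se.
  by split=> // c y h; rewrite eS; exact: es.
exists e; split=> [i|c]; first by case: (eQ i).
have [N] : exists N, (size c <= N)%N by exists (size c).
elim: N c => [|N IHN] c szc h ch.
  by move=> i; rewrite nth_default ?dvdz0 // (leq_trans szc).
pose c' := take_poly N c.
have c'E : comb e c' = \sum_(i < N) e i *~ c`_i.
  rewrite (@comb_widen _ _ _ N) ?size_take_poly //.
  by apply: eq_bigr => i _; rewrite coef_take_poly ltn_ord.
move: (ch); rewrite (@comb_widen _ _ _ N.+1) // big_ord_recr /= -c'E => chN.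
have oN : (o N %| c`_N)%Z.
  have [_ /(_ c`_N (- comb e c') h)] := eQ N; apply.
    by apply: sgN; [exact: span_subgroup|rewrite c'E; exists (fun i => c`_i)].
  by rewrite -chN addKr.
have eN0 : e N *~ c`_N = 0.
  have /dvdzP[k ->] := oN.
  by rewrite mulrC mulrzA -pmulrn (proj1 (eQ N)) mul0rz.
move=> i; have [lt_iN|] := ltnP i N.
  have := IHN c' (size_take_poly _ _) h; rewrite -chN eN0 addr0.
  by move=> /(_ erefl i); rewrite coef_take_poly lt_iN.
rewrite leq_eqVlt => /orP[/eqP<-//|lt_Ni].
by rewrite nth_default ?dvdz0 // (leq_trans szc).
Qed.

(** Decoding [i] as a pair [(k, c)] lists every [c] infinitely often. Values not killed by [o i] are
    replaced by 0, but [o i] kills [z] for all large [i], so a late occurrence of [z] survives. *)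
Lemma enumerate_annihilated (C : countType) (Z : zmodType) (g : C -> Z)
    (o : nat -> nat) :
  (forall z, exists c, g c = z) ->
  (forall z : Z, exists K, forall i, (K <= i)%N -> z *+ o i = 0) ->
  exists u : nat -> Z,
    (forall i, u i *+ o i = 0) /\ forall z, exists i, u i = z.
Proof.
move=> g_surj tors.
pose d i : Z := if @unpickle (nat * C)%type i is Some (_, c) then g c else 0.
exists (fun i => if d i *+ o i == 0 then d i else 0); split=> [i|z].
  by case: eqP => // _; rewrite mul0rn.
have [c gc] := g_surj z; have [K KP] := tors z.
suff [k le_Kk] : exists k : nat, (K <= pickle (k, c))%N.
  exists (pickle (k, c)); rewrite /d pickleK gc.
  by rewrite KP // eqxx.
apply: contrapT => /forallNP small.
suff : (size [seq pickle (k, c) | k <- iota 0 K.+1] <= size (iota 0 K))%N.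
  by rewrite size_map !size_iota ltnn.
apply: uniq_leq_size.
  rewrite map_inj_uniq ?iota_uniq // => i j.
  move=> /(congr1 (@unpickle (nat * C)%type)).
  by rewrite !pickleK => -[].
by move=> _ /mapP[k _ ->]; rewrite mem_iota add0n /= ltnNge; apply/negP/small.
Qed.

Lemma coef_comb_scaleX (R : nzRingType) (a : nat -> R) c i :
  (comb (fun j => a j *: 'X^j) c)`_i = a i *~ c`_i.
Proof.
have -> : comb (fun j => a j *: 'X^j) c = \poly_(j < size c) (a j *~ c`_j).
  by rewrite poly_def; apply: eq_bigr => j _; rewrite scalerMzl.
rewrite coef_poly; case: ltnP => // szc.
by rewrite nth_default // mulr0z.
Qed.

(** * Infinite ranks exclude both properties *)

Section Necessity.
Variable G : zmodType.

Definition non_co_Bassian : Prop :=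
  ~ finitely_co_Bassian G /\ ~ semi_co_Bassian G.

Lemma doubling_non_co_Bassian (C : countType) (W : zmodType) (g : C -> W) q o
    (e : nat -> G) (w : nat -> W) :
  bounded_injective q W -> direct_mod q o e -> direct_mod 0 o w ->
  (forall i, o i != 1%N) -> (forall z, exists c, g c = z) ->
  (forall z : W, exists K, forall i, (K <= i)%N -> z *+ o i = 0) ->
  non_co_Bassian.
Proof.
move=> injW de dw o1 g_surj tors.
have [|z|u [uo u_surj]] := @enumerate_annihilated (C * C)%type (W * W)%type
    (fun c => (g c.1, g c.2)) o.
- move=> [a b]; have [c <-] := g_surj a; have [d <-] := g_surj b.
  by exists (c, d).
- case: z => a b; have [K KP] := tors a; have [L LP] := tors b.
  exists (maxn K L) => i; rewrite geq_max => /andP[Ki Li].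
  rewrite [LHS]surjective_pairing (raddfMn fst) (raddfMn snd) /=.
  by rewrite KP // LP.
split; first exact: (doubling_not_finitely_co_Bassian injW de dw o1 uo u_surj).
exact: (doubling_not_semi_co_Bassian injW de dw o1 uo u_surj).
Qed.

(** [{poly rat}] is a countable sum of copies of Q. If the greedy choice were stuck at [s], every
    element would have a multiple by a non-zero integer in the span of [s], which bounds the
    rank. *)
Lemma infinite_rank_non_co_Bassian :
  ~ finite_torsion_free_rank G -> non_co_Bassian.
Proof.
move=> inf; have [n s _|e de] := @direct_mod_greedy G 0 (fun=> 0%N).
  apply: contrapT => nx; apply: inf.
  apply: (@span_finite_rank _ n (fun i : 'I_n => s i)) => x.
  apply: contrapT => nc; apply: nx; exists x => // c y h sy.
  rewrite mulr0n addr0 => xc; rewrite dvd0z; apply: contrapT => /negP c0.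
  by apply: nc; exists c; rewrite ?xc.
apply: (doubling_non_co_Bassian (C := {poly rat}) (g := id)
  (w := fun i => 1 *: 'X^i) _ de) => //.
- move=> m z m0 _ _; exists (m%:R^-1 *: z).
  by rewrite -scaler_nat scalerA mulfV ?scale1r // pnatr_eq0 -lt0n.
- split=> // c h; rewrite mulr0n => c0 i; rewrite dvd0z.
  have := coef_comb_scaleX (fun=> 1 : rat) c i; rewrite c0 coef0.
  by move=> /esym/eqP; rewrite intr_eq0.
- by move=> z; exists z.
- by exists 0%N.
Qed.

(** * Infinite [p]-socles *)

Section PrimaryCase.
Variable p : nat.
Hypothesis p_pr : prime p.

(** Height at least [k], not exactly [k]: the [p]-socle of [p ^ k G]. *)
Definition socle_height k (x : G) : Prop :=
  x *+ p = 0 /\ exists g, x = g *+ p ^ k.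

(** The span of [s] and the socle of [q G] are finite, so the span plus [q G] contains finitely many
    socle elements and misses some socle element [p ^ k g]. If it contained [c g] with [c] not
    divisible by [p ^ k.+1], Bezout would put [p ^ k g] into it. *)
Lemma direct_mod_socle q (k : nat -> nat) :
  (forall n t, ~ covers (socle_height (k n)) (eq^~ 0) t) ->
  (exists t,
    covers (fun x : G => x *+ p = 0 /\ exists g, x = g *+ q) (eq^~ 0) t) ->
  exists e : nat -> G, direct_mod q (fun n => p ^ (k n).+1)%N e.
Proof.
move=> inf [t0 cov0]; apply: direct_mod_greedy => n s tors.
pose v (i : 'I_n) := s i.
pose d := (\prod_(i < n) p ^ (k i).+1)%N.
have d0 : (0 < d)%N by apply: prodn_gt0 => i; rewrite expn_gt0 prime_gt0.
have vd i : v i *+ d = 0.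
  by rewrite /d (bigD1 i) //= mulrnA tors // mul0rn.
have [t covt] := covers_span v d0.
pose qG (x : G) := exists2 h, True & x = h *+ q.
have sqG : is_subgroup qG by apply: mulrn_im_subgroup.
pose R (x : G) := x *+ p = 0 /\ exists y h, span v y /\ x = y + h *+ q.
have covR : covers (fun x => exists y h, span v y /\ x = y + h *+ q) qG t.
  move=> _ [y [h [sy ->]]]; have [z zt [c yz]] := covt y sy.
  exists z => //; exists h => //; rewrite addrAC yz big1 ?add0r // => i _.
  by rewrite vd mul0rz.
have [t1 _ cov1] : exists2 t1, (size t1 <= size t)%N &
    covers R (fun x => x *+ p = 0 /\ exists g, x = g *+ q) t1.
  apply: (covers_pullback (f := id) sqG covR) => [x []//|].
  move=> x y [xp _] [yp _] [g _ xy].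
  by split; [rewrite mulrnBl xp yp subrr|exists g].
have cov2 := covers_trans cov1 cov0.
have [x [[xp [g xg]] ng]] : exists x, socle_height (k n) x /\ ~ R x.
  apply: contrapT => nx; apply: (inf n _) => x hx.
  by apply: cov2; apply: contrapT => nR; apply: nx; exists x.
rewrite xg in xp ng.
exists g; first by rewrite expnSr mulrnA.
move=> c y h sy gc; apply: contrapT => /negP npc; apply: ng; split=> //.
have pk0 j : (0 < p ^ j)%N by rewrite expn_gt0 prime_gt0.
(* The gcd is a power of [p] strictly below the full modulus, hence divides [p ^ k n]. *)
have /dvdzP[a aE] : (gcdz c (p ^ (k n).+1)%N %| (p ^ k n)%N%:Z)%Z.
  have /(dvdn_pfactor _ _ p_pr)[j lej gE] := dvdn_gcdr `|c| (p ^ (k n).+1).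
  rewrite dvdzE /gcdz /= gE dvdn_Pexp2l ?prime_gt1 //.
  rewrite -ltnS ltn_neqAle lej andbT.
  apply: contraNneq npc => jE; rewrite dvdzE /= -jE -gE; exact: dvdn_gcdl.
have [b [b' bE]] := Bezoutz c (p ^ (k n).+1)%N.
exists (y *~ (a * b)), (h *~ (a * b)); split.
  by apply: sgMz => //; exact: span_subgroup.
have gp0 : g *~ (p ^ (k n).+1)%N = 0 by rewrite -pmulrn expnSr mulrnA.
have -> : g *+ p ^ k n = g *~ c *~ (a * b) + g *~ (p ^ (k n).+1)%N *~ (a * b').
  rewrite pmulrn aE -bE -!mulrzA -mulrzDr; congr (_ *~ _).
  by move: (Posz (p ^ (k n).+1)) => P; ring.
by rewrite gp0 mul0rz addr0 gc mulrzDl !pmulrn -!mulrzA [q%:Z * _]mulrC.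
Qed.

(** [W] is a sum of copies of Z(p^oo), each built as Q modulo the rationals with denominator prime
    to [p]; [w i] is the class of [X^i / p ^ i.+1]. Since [W] is divisible, [q = 0] is allowed. *)
Lemma unbounded_heights_non_co_Bassian :
  (forall k t, ~ covers (socle_height k) (eq^~ 0) t) -> non_co_Bassian.
Proof.
move=> inf.
have [||e de] := @direct_mod_socle 0 id.
- by move=> n; exact: inf.
- exists [:: 0] => x [_ [g ->]]; exists 0; rewrite ?mem_head //.
  by rewrite mulr0n subrr.
pose integral (a : rat) := exists2 d : nat, ~~ (p %| d)%N &
  exists b : int, a *+ d = b%:~R.
have s_integral : is_subgroup integral.
  split=> [|a b [m pm [i ai]] [n pn [j bj]]].
    by exists 1%N; [rewrite Euclid_dvd1|exists 0; rewrite mul0rn].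
  exists (m * n)%N; first by rewrite Euclid_dvdM // negb_or pm.
  exists (i * n - j * m); rewrite mulrnBl mulrnA ai mulnC mulrnA bj.
  by rewrite rmorphB !rmorphM /= !mulr_natr.
pose P (f : {poly rat}) := forall i, integral f`_i.
have sP : is_subgroup P.
  split=> [i|f g Pf Pg i]; first by rewrite coef0; exact: sg0 s_integral.
  by rewrite coefB; exact: sgB.
pose W := ({poly rat} /s subgroup_of sP)%type.
pose a i : rat := (p ^ i.+1)%:R^-1.
have pn0 i : (p ^ i)%:R != 0 :> rat.
  by rewrite pnatr_eq0 -lt0n expn_gt0 prime_gt0.
apply: (doubling_non_co_Bassian (C := {poly rat}) (g := @qpi _ (subgroup_of sP))
  (w := fun i => qpi (subgroup_of sP) (a i *: 'X^i)) _ de).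
- move=> m z m0 _ _; exists (qpi _ (m%:R^-1 *: repr z)).
  rewrite -raddfMn -scaler_nat scalerA mulfV ?scale1r ?pnatr_eq0 -?lt0n //.
  exact: qpi_reprK.
- split=> [i|c h].
    rewrite -raddfMn; apply/qpi_eq0/subgroup_ofE => j.
    rewrite -scaler_nat scalerA mulfV // scale1r coefXn.
    exists 1%N; first by rewrite Euclid_dvd1.
    by exists (j == i); case: (j == i).
  rewrite mulr0n -(raddf_comb (qpi (subgroup_of sP))).
  move=> /qpi_eq0/subgroup_ofE + i => /(_ i)[d pd [b]].
  rewrite coef_comb_scaleX /a => cE.
  have eq_b : c`_i * d = b * (p ^ i.+1)%N.
    have cE' : (p ^ i.+1)%:R^-1 * (c`_i)%:~R * d%:R = b%:~R :> rat.
      by rewrite mulrzr mulr_natr.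
    apply: (@intr_inj rat); rewrite !rmorphM /= -cE' -!pmulrn [RHS]mulrC.
    by rewrite !mulrA mulfV ?mul1r.
  have : ((p ^ i.+1)%N %| c`_i * d)%Z by rewrite eq_b dvdz_mull.
  rewrite Gauss_dvdzl // coprimezE /=.
  by rewrite coprimeXl // prime_coprime.
- by move=> i; rewrite expnS muln_eq1 negb_and (gtn_eqF (prime_gt1 p_pr)).
- by move=> z; exists (repr z); exact: qpi_reprK.
- move=> z; have [f [b b0 fE]] := rat_poly_scale (repr z).
  have b_gt0 : (0 < `|b|)%N by rewrite absz_gt0.
  have [d cop_d dE] := pfactor_coprime p_pr b_gt0.
  exists (logn p `|b|) => i le_bi.
  rewrite -[z]qpi_reprK -raddfMn; apply/qpi_eq0/subgroup_ofE => j.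
  exists d; first by rewrite -prime_coprime.
  (* Up to sign, [b] is [d] times a power of [p]; multiplying by [d] and [p ^ i.+1] cancels it and
     leaves this integer. *)
  exists (sgz b * f`_j * (p ^ (i.+1 - logn p `|b|))%N).
  rewrite !coefMn fE coefZ coef_map /=.
  have bE : b = sgz b * (d * p ^ logn p `|b|)%N by rewrite -dE -intEsg.
  have bP : b * (sgz b * f`_j * (p ^ (i.+1 - logn p `|b|))%N) =
      f`_j * (p ^ i.+1)%N * d.
    rewrite -[in RHS](subnK (leqW le_bi)) expnD [X in X * _]bE !PoszM.
    have : sgz b * sgz b = 1 by rewrite mulz_sg b0.
    move: (sgz b) (Posz (p ^ _)) (Posz (p ^ _)) => sg_b p1 p2 sgb2.
    by rewrite -[RHS]mul1r -sgb2; ring.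
  have bQ : b%:~R != 0 :> rat by rewrite intr_eq0.
  apply: (mulfI bQ); rewrite -rmorphM bP !rmorphM /= -!pmulrn.
  have nat_mul (x : rat) m n : x *+ m *+ n = x * m%:R * n%:R.
    by rewrite !mulr_natr.
  by rewrite nat_mul !mulrA mulfV // mul1r.
Qed.

(** Self-injectivity of Z / q, coefficientwise: for [q = n m], an element killed by [n] has a
    representative divisible by [m]. *)
Lemma poly_Zp_bounded_injective q :
  (1 < q)%N -> bounded_injective q {poly 'Z_q}.
Proof.
move=> q1 m /= z m0 /dvdnP[n qE].
have n0 : (0 < n)%N by move: q1; rewrite qE; case: (n).
have -> : (q %/ m)%N = n by rewrite qE mulnK.
move=> zn; have mz (i : nat) : (m %| (z`_i)%R)%N.
  have : z`_i *+ n = 0 by rewrite -coefMn zn coef0.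
  rewrite -[X in X *+ n]natr_Zp -mulrnA => /(congr1 val) /=.
  rewrite val_Zp_nat // => /eqP; rewrite -/(dvdn q _) => qz.
  by rewrite -(dvdn_pmul2l n0) -qE mulnC.
exists (\poly_(i < size z) ((z`_i)%R %/ m)%:R).
apply/polyP => i; rewrite coefMn coef_poly; case: ltnP => [_|szi]; last first.
  by rewrite nth_default // mul0rn.
by rewrite -mulrnA divnK // natr_Zp.
Qed.

(** As [p ^ k.+1 G] has finite socle, the family can be chosen direct modulo [q G]; maps from it
    then extend into [{poly 'Z_q}], a sum of copies of Z / q. *)
Lemma bounded_heights_non_co_Bassian k :
  (forall t, ~ covers (socle_height k) (eq^~ 0) t) ->
  (exists t, covers (socle_height k.+1) (eq^~ 0) t) -> non_co_Bassian.
Proof.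
move=> inf fin; pose q := (p ^ k.+1)%N.
have [||e de] := @direct_mod_socle q (fun=> k) => //.
have q1 : (1 < q)%N by rewrite -(expn0 p) ltn_exp2l ?prime_gt1.
have q0 : q%:R = 0 :> 'Z_q by rewrite -(Zp_nat_mod q1) modnn.
have natZ0 n : (n%:R == 0 :> 'Z_q) = (q %| n)%N.
  by rewrite -val_eqE /= val_Zp_nat.
have polyq (z : {poly 'Z_q}) : z *+ q = 0.
  by apply/polyP => i; rewrite coefMn coef0 -mulr_natr q0 mulr0.
apply: (doubling_non_co_Bassian (C := {poly 'Z_q}) (g := id)
  (w := fun i => 1 *: 'X^i) _ de).
- exact: poly_Zp_bounded_injective.
- split=> [i|c h]; first exact: polyq.
  rewrite mulr0n => c0 i; have := coef_comb_scaleX (fun=> 1 : 'Z_q) c i.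
  rewrite c0 coef0; case: (c`_i) => n /esym/eqP.
    by rewrite -pmulrn natZ0.
  by rewrite NegzE mulrNz oppr_eq0 -pmulrn natZ0.
- by move=> _; rewrite neq_ltn q1 orbT.
- by move=> z; exists z.
- by move=> z; exists 0%N => i _; exact: polyq.
Qed.

(** If some [p ^ k G] has finite socle, the least such [k] is positive, since [k = 0] gives the
    whole [p]-torsion, and its predecessor is the bounded case. *)
Lemma infinite_socle_non_co_Bassian :
  (forall t, ~ covers (fun x : G => x *+ p = 0) (eq^~ 0) t) -> non_co_Bassian.
Proof.
move=> inf; pose fin k := `[< exists t, covers (socle_height k) (eq^~ 0) t >].
have [[k fink]|nfin] := pselect (exists k, fin k); last first.
  apply: unbounded_heights_non_co_Bassian => k t covt; apply: nfin; exists k.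
  by apply/asboolP; exists t.
have exk : exists k, fin k by exists k.
case: (ex_minnP exk) => -[|m] /asboolP finm minm.
  have [t covt] := finm; case: (inf t) => x xp; apply: covt; split=> //.
  by exists x; rewrite expn0.
apply: (@bounded_heights_non_co_Bassian m) => // t covt.
have /minm : fin m by apply/asboolP; exists t.
by rewrite ltnn.
Qed.

End PrimaryCase.

Lemma co_Bassian_finite_ranks : ~ non_co_Bassian ->
  finite_torsion_free_rank G /\
     forall p (p_pr : prime p), finite_p_rank p_pr G.
Proof.
move=> nexp; split=> [|p p_pr]; apply: contrapT => inf; apply: nexp.
  exact: infinite_rank_non_co_Bassian.
apply: (infinite_socle_non_co_Bassian p_pr) => t.
by move=> /(covers_finite_p_rank p_pr).
Qed.

End Necessity.

Theorem theorem3p4 (G : zmodType) :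
  (finitely_co_Bassian G <-> semi_co_Bassian G) /\
  (semi_co_Bassian G <->
     finite_torsion_free_rank G /\
     forall (p : nat) (pr_p : prime p), finite_p_rank pr_p G).
Proof.
have suff_ranks : finite_torsion_free_rank G /\
     (forall (p : nat) (pr_p : prime p), finite_p_rank pr_p G) ->
    finitely_co_Bassian G /\ semi_co_Bassian G.
  move=> [[n rankG] rankp].
  have finG : finite_torsion G.
    apply: prime_finite_torsion => p p_pr.
    exact: finite_p_rank_covers (rankp p p_pr).
  split=> H phi phi_inj.
    exact: image_finite_index rankG finG _ _ phi_inj.
  exact: image_essential rankG finG _ _ phi_inj.
have nec := @co_Bassian_finite_ranks G.
split; split=> [GB|GB].
- by apply: (proj2 (suff_ranks (nec _))) => -[/(_ GB)].
- by apply: (proj1 (suff_ranks (nec _))) => -[_ /(_ GB)].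
- by apply: nec => -[_ /(_ GB)].
- exact: (proj2 (suff_ranks GB)).
Qed.
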